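(* Let $r\ge 6$ and $n\ge 1$ be integers, and let $P$ be a doubly-stochastic $n\times n$ matrix with $P(i,j)\le \frac1r$ for all $i,j$. Then $\mathrm{per}(P)\le(\sqrt2)^n F(P)$.
   Context: A doubly-stochastic matrix is an entrywise non-negative square matrix all of whose row and column sums equal $1$. $\mathrm{per}$ is the permanent. $F(P)=\prod_{1\le i,j\le n}(1-P(i,j))^{1-P(i,j)}$, with $0^0=1$. *)

(* Defs.v *)
From HB Require Import structures.
From mathcomp Require Import all_boot all_order all_algebra all_fingroup.
From mathcomp Require Import reals exp.
Set Implicit Arguments. Unset Strict Implicit. Unset Printing Implicit Defensive.
Import Order.TTheory GRing.Theory Num.Theory.
Local Open Scope ring_scope.

Definition doubly_stochastic (R : realType) (n : nat) (P : 'M[R]_n) : Prop :=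
  (forall i j, 0 <= P i j) /\
  (forall i, \sum_(j < n) P i j = 1) /\
  (forall j, \sum_(i < n) P i j = 1).

Definition per (R : realType) (n : nat) (P : 'M[R]_n) : R :=
  \sum_(s : 'S_n) \prod_(i < n) P i (s i).

(* F(P) = prod_{i,j} (1 - P(i,j))^(1 - P(i,j)), with 0^0 = 1 (powR 0 0 = 1). *)
Definition F (R : realType) (n : nat) (P : 'M[R]_n) : R :=
  \prod_(i < n) \prod_(j < n) powR (1 - P i j) (1 - P i j).

(* Main.v *)
Require Import Defs.
From HB Require Import structures.
From mathcomp Require Import all_boot all_order all_algebra all_fingroup.
From mathcomp Require Import reals exp sequences ring lra.
Import Order.TTheory GRing.Theory Num.Theory.
Local Open Scope ring_scope.

Set Implicit Arguments. Unset Strict Implicit. Unset Printing Implicit Defensive.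

(* The permanent is affine in each row, and the constraints 0 <= p_j <= 1/6,
   sum_j p_j <= 1 on a row cut out a polytope whose vertices have all entries in
   {0, 1/6}.  Moving the rows one at a time to vertices that do not decrease the
   permanent reduces the bound to P = B/6 with B a 0-1 matrix with row sums at most 6.
   Bregman's theorem, proved by Schrijver's entropy argument, gives
   per B <= prod_i (r_i!)^(1/r_i) <= (6!)^(n/6) <= 3^n, hence per P <= 2^-n.
   On the other side (1-p)^(1-p) >= e^-p and the rows of P sum to 1, so
   F(P) >= e^-n, and 1/2 <= sqrt 2 / e. *)

Section Permanent.
Variable R : realType.

Lemma per0 (A : 'M[R]_0) : per A = 1.
Proof.
rewrite /per (eq_bigr (fun _ => 1)) => [|s _]; last by rewrite big_ord0.
by rewrite sumr_const card_Sn.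
Qed.

Lemma per_ge0 n (A : 'M[R]_n) : (forall i j, 0 <= A i j) -> 0 <= per A.
Proof. by move=> A0; apply: sumr_ge0 => s _; apply: prodr_ge0. Qed.

Lemma perZ n (a : R) (A : 'M[R]_n) : per (a *: A) = a ^+ n * per A.
Proof.
rewrite /per mulr_sumr; apply: eq_bigr => s _.
rewrite -[in a ^+ n](card_ord n) -prodr_const -big_split.
by apply: eq_bigr => i _; rewrite mxE.
Qed.

Lemma expand_per_minor n (A : 'M[R]_n.+1) i0 j0 :
  \sum_(s : 'S_n.+1 | s i0 == j0) \prod_(k | i0 != k) A k (s k)
  = per (row' i0 (col' j0 A)).
Proof.
rewrite /per (reindex (lift_perm i0 j0)); last first.
  pose ulsf i (s : 'S_n.+1) k := odflt k (unlift (s i) (s (lift i k))).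
  have ulsfK i (s : 'S_n.+1) k : lift (s i) (ulsf i s k) = s (lift i k).
    rewrite /ulsf; have:= neq_lift i k.
    by rewrite -(can_eq (permK s)) => /unlift_some[] ? ? ->.
  have inj_ulsf : injective (ulsf i0 _).
    move=> s; apply: can_inj (ulsf (s i0) s^-1%g) _ => k'.
    by rewrite {1}/ulsf ulsfK !permK liftK.
  exists (fun s => perm (inj_ulsf s)) => [s _ | s].
    by apply/permP=> k'; rewrite permE /ulsf lift_perm_lift lift_perm_id liftK.
  move/(s _ =P _) => si0; apply/permP=> k.
  case: (unliftP i0 k) => [k'|] ->; rewrite ?lift_perm_id //.
  by rewrite lift_perm_lift -si0 permE ulsfK.
apply: eq_big => [s | s _]; first by rewrite lift_perm_id eqxx.
case: (pickP 'I_n) => [k0 _ | n0]; last first.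
  by rewrite !big1 // => [i _ | j /unlift_some[i] _ _]; have:= n0 i.
rewrite (reindex (lift i0)).
  by apply: eq_big => [k | k _] /=; rewrite ?neq_lift // !mxE lift_perm_lift.
exists (fun k => odflt k0 (unlift i0 k)) => k; first by rewrite liftK.
by case/unlift_some=> k' -> ->.
Qed.

Lemma sum_perm_fixE n (A : 'M[R]_n.+1) i k :
  \sum_(s : 'S_n.+1 | s i == k) \prod_j A j (s j)
  = A i k * per (row' i (col' k A)).
Proof.
rewrite -expand_per_minor big_distrr /=; apply: eq_bigr => s /eqP <-.
by rewrite (bigD1 i) //=; congr (_ * _); apply: eq_bigl => j; rewrite eq_sym.
Qed.

Lemma expand_per_row n (A : 'M[R]_n.+1) i :
  per A = \sum_k A i k * per (row' i (col' k A)).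
Proof.
rewrite /per (partition_big (fun s : 'S_n.+1 => s i) xpredT) //=.
by apply: eq_bigr => k _; rewrite sum_perm_fixE.
Qed.

End Permanent.

Section Bregman.
Variable R : realType.

Lemma ln_le_subr1 (x : R) : 0 < x -> ln x <= x - 1.
Proof.
by move=> x_gt0; have := @le_ln1Dx R (x - 1); rewrite addrCA subrr addr0; apply; lra.
Qed.

Lemma entropy_le_ln_card (I : finType) (S : {pred I}) (x : I -> R) :
  (forall k, 0 <= x k) -> (forall k, k \notin S -> x k = 0) -> 0 < \sum_k x k ->
  (\sum_k x k) * ln (\sum_k x k) <= (\sum_k x k) * ln #|S|%:R + \sum_k x k * ln (x k).
Proof.
move=> x0 xS; set N := \sum_k x k => N0.
have r0 : 0 < #|S|%:R :> R.
  rewrite ltr0n lt0n; apply: contraTneq N0 => /card0_eq S0.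
  by rewrite /N big1 ?ltxx // => k _; apply: xS; rewrite S0.
set r := #|S|%:R in r0 *.
(* Gibbs' inequality term by term: ln (N / (r x_k)) <= N / (r x_k) - 1. *)
have xk_le k : x k * ln N <=
    x k * ln (x k) + x k * ln r + ((if k \in S then N / r else 0) - x k).
  have [-> | xk_neq0] := eqVneq (x k) 0.
    by rewrite !mul0r !add0r subr0; case: ifP => // _; rewrite divr_ge0 ?ltW.
  have xk_gt0 : 0 < x k by rewrite lt0r xk_neq0 x0.
  have -> : k \in S by apply: contraNT xk_neq0 => /xS ->.
  have := ln_le_subr1 (divr_gt0 N0 (mulr_gt0 xk_gt0 r0)).
  rewrite ln_div ?lnM ?posrE ?mulr_gt0 // => /(ler_wpM2l (ltW xk_gt0)).
  have -> : x k * (N / (x k * r) - 1) = N / r - x k by field; rewrite !gt_eqF.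
  lra.
have S_mass : \sum_k (if k \in S then N / r else 0) = N.
  by rewrite -big_mkcond sumr_const -mulr_natr divfK ?gt_eqF.
rewrite {1}/N mulr_suml; apply: le_trans (ler_sum _ (fun k _ => xk_le k)) _.
rewrite big_split /= big_split /= big_split /= S_mass -!mulr_suml sumrN -/N; lra.
Qed.

Definition zero_one n (A : 'M[R]_n) := forall i j, A i j = 0 \/ A i j = 1.

Definition row_count n (A : 'M[R]_n) i : nat := (\sum_j (A i j != 0%R))%N.

(* ln ((r!)^(1/r)); at r = 0 the division by zero makes it 0. *)
Definition bregman_log (r : nat) : R := ln r`!%:R / r%:R.

Lemma zero_one_minor n (A : 'M[R]_n.+1) i k : zero_one A -> zero_one (row' i (col' k A)).
Proof. by move=> A01 x y; rewrite !mxE. Qed.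

Lemma row_sum_zero_one n (A : 'M[R]_n) i : zero_one A -> \sum_j A i j = (row_count A i)%:R.
Proof.
move=> A01; rewrite natr_sum; apply: eq_bigr => j _.
by case: (A01 i j) => ->; rewrite ?eqxx ?oner_eq0.
Qed.

Lemma row_count_minor n (A : 'M[R]_n.+1) i k x :
  row_count (row' i (col' k A)) x = (row_count A (lift i x) - (A (lift i x) k != 0%R))%N.
Proof.
rewrite /row_count (bigD1_ord k (P := xpredT)) //= addnC addnK.
by apply: eq_bigr => y _; rewrite !mxE.
Qed.

Lemma mulr_bregman_log r : r%:R * bregman_log r = ln r`!%:R.
Proof.
case: r => [|r]; first by rewrite mul0r fact0 ln1.
by rewrite mulrC divfK ?pnatr_eq0.
Qed.

Lemma bregman_logS r : r.+1%:R * bregman_log r.+1 = ln r.+1%:R + r%:R * bregman_log r.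
Proof. by rewrite !mulr_bregman_log factS natrM lnM ?posrE ?ltr0n ?fact_gt0. Qed.

Lemma fact_le_expS r : (r`! <= r.+1 ^ r)%N.
Proof.
elim: r => // r IH; rewrite factS expnS leq_mul // (leq_trans IH) //.
by case: r {IH} => // r; rewrite leq_exp2r.
Qed.

Lemma bregman_log_le_ln r : bregman_log r <= ln r.+1%:R.
Proof.
case: r => [|r]; first by rewrite /bregman_log fact0 ln1 mul0r.
have r_gt0 : 0 < r.+1%:R :> R by rewrite ltr0n.
rewrite -(ler_pM2l r_gt0) mulr_bregman_log mulr_natl -lnXn ?ltr0n // -natrX.
by rewrite ler_ln ?posrE ?ltr0n ?expn_gt0 ?fact_gt0 // ler_nat fact_le_expS.
Qed.

Lemma bregman_log_nondecreasing : {homo bregman_log : r s / (r <= s)%N >-> r <= s}.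
Proof.
apply: homo_leq => [//|? ? ? |r]; first exact: le_trans.
have r1_gt0 : 0 < r.+1%:R :> R by rewrite ltr0n.
rewrite -(ler_pM2l r1_gt0) bregman_logS -natr1 mulrDl mul1r addrC lerD2r.
by rewrite natr1 bregman_log_le_ln.
Qed.

Lemma sum_bregman_log_row n (A : 'M[R]_n) i : (0 < row_count A i)%N ->
  \sum_k bregman_log (row_count A i - (A i k != 0%R)) - bregman_log (row_count A i).-1
  = n%:R * bregman_log (row_count A i) - ln (row_count A i)%:R.
Proof.
have := erefl (row_count A i); rewrite {2}/row_count.
case: (row_count A i) => // r r_def _ /=.
have -> : \sum_k bregman_log (r.+1 - (A i k != 0%R))
    = \sum_k ((A i k != 0%R)%:R * bregman_log r + (1 - (A i k != 0%R)%:R) * bregman_log r.+1).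
  by apply: eq_bigr => k _; case: (A i k != 0%R); rewrite ?subn1 ?subn0 /=; ring.
rewrite big_split /= -!mulr_suml sumrB sumr_const card_ord -natr_sum -r_def.
have := bregman_logS r; rewrite -natr1; lra.
Qed.

(* Schrijver's inductive step: for each row i, expand per A along row i and bound
   its entropy by ln (row_count A i); bound the ln of each minor by induction; then
   average over i and regroup the double sum by permutations. *)
Section BregmanStep.
Variables (n : nat) (A : 'M[R]_n.+1).
Hypotheses (A01 : zero_one A) (perA_gt0 : 0 < per A).
Local Notation cof i k := (per (row' i (col' k A))).
Hypothesis ln_cof_le : forall i k, 0 < cof i k ->
  ln (cof i k) <= \sum_x bregman_log (row_count (row' i (col' k A)) x).

Let A_ge0 i j : 0 <= A i j.
Proof. by case: (A01 i j) => ->. Qed.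

Let cof_ge0 i k : 0 <= cof i k.
Proof. by apply: per_ge0 => x y; rewrite !mxE. Qed.

Lemma row_count_gt0 i : (0 < row_count A i)%N.
Proof.
rewrite lt0n; apply: contraTneq perA_gt0 => r0.
have : \sum_j A i j = 0 by rewrite row_sum_zero_one // r0.
move/psumr_eq0P => Ai0; rewrite (expand_per_row A i) big1 ?ltxx // => k _.
by rewrite Ai0 ?mul0r.
Qed.

Lemma xlnx_per_le i : per A * ln (per A)
  <= per A * ln (row_count A i)%:R + \sum_k A i k * cof i k * ln (cof i k).
Proof.
have card_S : #|[pred k | A i k != 0]| = row_count A i.
  by rewrite -sum1_card big_mkcond.
have := @entropy_le_ln_card _ [pred k | A i k != 0] (fun k => A i k * cof i k).
have xlnx_eq : \sum_k A i k * cof i k * ln (A i k * cof i k)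
    = \sum_k A i k * cof i k * ln (cof i k).
  by apply: eq_bigr => k _; case: (A01 i k) => ->; rewrite ?mul0r ?mul1r.
rewrite card_S -expand_per_row -xlnx_eq; apply => // k.
- exact: mulr_ge0.
- by rewrite inE negbK => /eqP ->; rewrite mul0r.
Qed.

(* The induction hypothesis for the minor (i, k), after [row_count_minor]. *)
Let bound i k := \sum_j bregman_log (row_count A j - (A j k != 0%R))
  - bregman_log (row_count A i - (A i k != 0%R)).

Lemma xlnx_cof_le_bound i k : A i k * cof i k * ln (cof i k) <= A i k * cof i k * bound i k.
Proof.
have [-> | ACk_neq0] := eqVneq (A i k * cof i k) 0; first by rewrite !mul0r.
have cof_gt0 : 0 < cof i k.
  by rewrite lt0r cof_ge0 andbT; apply: contraNneq ACk_neq0 => ->; rewrite mulr0.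
rewrite ler_wpM2l ?mulr_ge0 // (le_trans (ln_cof_le cof_gt0)) //.
under eq_bigr => x _ do rewrite row_count_minor.
by rewrite /bound (bigD1_ord i) //= addrC addrK.
Qed.

Lemma sum_ln_cof_bound_perm (s : 'S_n.+1) : (forall j, A j (s j) = 1) ->
  \sum_i bound i (s i)
  = \sum_i (n.+1%:R * bregman_log (row_count A i) - ln (row_count A i)%:R).
Proof.
move=> As1; rewrite /bound sumrB exchange_big.
rewrite -(eq_bigr _ (fun j _ => sum_bregman_log_row (row_count_gt0 j))) sumrB; congr (_ - _).
  by apply: eq_bigr => j _; rewrite [RHS](reindex_inj (@perm_inj _ s)).
by apply: eq_bigr => i _; rewrite As1 oner_eq0 subn1.
Qed.

Lemma sum_weighted_ln_cof_bound : \sum_i \sum_k A i k * cof i k * bound i k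
  = per A * \sum_i (n.+1%:R * bregman_log (row_count A i) - ln (row_count A i)%:R).
Proof.
have row_as_perm i : \sum_k A i k * cof i k * bound i k
    = \sum_(s : 'S_n.+1) (\prod_j A j (s j)) * bound i (s i).
  rewrite [RHS](partition_big (fun s : 'S_n.+1 => s i) xpredT) //=.
  apply: eq_bigr => k _; rewrite -sum_perm_fixE mulr_suml.
  by apply: eq_bigr => s /eqP ->.
rewrite (eq_bigr _ (fun i _ => row_as_perm i)) exchange_big /= /per mulr_suml.
apply: eq_bigr => s _; rewrite -big_distrr /=.
have [-> | w_neq0] := eqVneq (\prod_j A j (s j)) 0; first by rewrite !mul0r.
congr (_ * _); apply: sum_ln_cof_bound_perm => j.
by case: (A01 j (s j)) => // Aj0; move: w_neq0; rewrite (bigD1 j) //= Aj0 mul0r eqxx.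
Qed.

Lemma bregman_step : ln (per A) <= \sum_i bregman_log (row_count A i).
Proof.
have : n.+1%:R * (per A * ln (per A))
    <= per A * \sum_i ln (row_count A i)%:R + \sum_i \sum_k A i k * cof i k * bound i k.
  have -> : n.+1%:R * (per A * ln (per A)) = \sum_(i < n.+1) per A * ln (per A).
    by rewrite sumr_const card_ord mulr_natl.
  rewrite mulr_sumr -big_split /=.
  apply: ler_sum => i _; apply: le_trans (xlnx_per_le i) _.
  by rewrite lerD2l; apply: ler_sum => k _; apply: xlnx_cof_le_bound.
rewrite sum_weighted_ln_cof_bound -mulrDr -big_split /=.
under eq_bigr => i _ do rewrite addrC subrK.
by rewrite -mulr_sumr mulrCA !ler_pM2l ?ltr0n.
Qed.

End BregmanStep.

Theorem bregman n (A : 'M[R]_n) : zero_one A -> 0 < per A ->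
  ln (per A) <= \sum_i bregman_log (row_count A i).
Proof.
elim: n A => [|n IH] A A01 perA_gt0; first by rewrite per0 ln1 big_ord0.
apply: bregman_step => // i k; apply: IH; exact: zero_one_minor.
Qed.

End Bregman.

Arguments bregman_log {R} r.

Section ExtremeMajorant.
Variables (R : realType) (I : finType) (M : R).

Lemma shift_mass_to_max (p c : I -> R) (k0 : I) :
  (forall k, 0 <= p k <= M) -> 0 <= c k0 -> (forall k, c k <= c k0) ->
  exists p' : I -> R, [/\ forall k, 0 <= p' k <= M, p' k0 = 0,
    \sum_k p' k <= Num.max 0 (\sum_k p k - M)
    & \sum_k p k * c k <= M * c k0 + \sum_k p' k * c k].
Proof.
move=> p_bnd c0 c_max; have p_ge0 k : 0 <= p k by case/andP: (p_bnd k).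
have M_ge0 : 0 <= M by case/andP: (p_bnd k0) => /le_trans; apply.
set S' := \sum_(k | k != k0) p k.
have S'_ge0 : 0 <= S' by apply: sumr_ge0.
have sum_p : \sum_k p k = p k0 + S' by rewrite (bigD1 k0).
have d_ge0 : 0 <= M - p k0 by rewrite subr_ge0; case/andP: (p_bnd k0).
have [t [t_ge0 t_le1 tS'_le sum_le]] : exists t, [/\ 0 <= t, t <= 1,
    t * S' <= M - p k0 & (1 - t) * S' <= Num.max 0 (\sum_k p k - M)].
  case: (lerP S' (M - p k0)) => [S'_le | lt_S'].
    by exists 1; split; rewrite ?mul1r ?subrr ?mul0r ?le_max ?lexx.
  have S'_gt0 : 0 < S' by apply: le_lt_trans lt_S'.
  exists ((M - p k0) / S'); split.
  - exact: divr_ge0 (ltW S'_gt0).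
  - by rewrite ler_pdivrMr // mul1r ltW.
  - by rewrite divfK ?gt_eqF.
  - by rewrite mulrBl mul1r divfK ?gt_eqF // sum_p le_max; apply/orP; right; lra.
exists (fun k => if k == k0 then 0 else (1 - t) * p k); split.
- move=> k; case: ifP => _; first by rewrite lexx M_ge0.
  case/andP: (p_bnd k) => pk0 pkM; rewrite mulr_ge0 ?subr_ge0 //=; nra.
- by rewrite eqxx.
- rewrite (bigD1 k0) //= eqxx add0r (eq_bigr (fun k => (1 - t) * p k)).
    by rewrite -mulr_sumr.
  by move=> k /negbTE ->.
have W_le : \sum_(k | k != k0) p k * c k <= S' * c k0.
  by rewrite mulr_suml; apply: ler_sum => k _; rewrite ler_wpM2l.
rewrite (bigD1 k0) //= [X in _ <= _ + X](bigD1 k0) //= eqxx mul0r add0r.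
rewrite [X in _ <= _ + X](eq_bigr (fun k => (1 - t) * (p k * c k))); last first.
  by move=> k /negbTE ->; rewrite mulrA.
rewrite -mulr_sumr; have := ler_wpM2l t_ge0 W_le; have := ler_wpM2r c0 tS'_le.
move: (\sum_(k | k != k0) p k * c k) => W; nra.
Qed.

(* Saturate a coordinate where c is largest, then recurse on the remaining budget. *)
Lemma exists_extreme_majorant (m : nat) (p c : I -> R) :
  0 <= M -> (forall k, 0 <= p k <= M) -> (forall k, 0 <= c k) ->
  \sum_k p k <= m%:R * M ->
  exists q : I -> R, [/\ forall k, q k = 0 \/ q k = M, \sum_k q k <= m%:R * M
    & \sum_k p k * c k <= \sum_k q k * c k].
Proof.
move=> M_ge0; elim: m p c => [|m IH] p c p_bnd c_ge0 sum_p.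
  have p_ge0 k : 0 <= p k by case/andP: (p_bnd k).
  have p0 k : p k = 0.
    apply: (psumr_eq0P (P := xpredT)) => //.
    by apply/eqP; rewrite eq_le sumr_ge0 // andbT (le_trans sum_p) // mul0r.
  exists (fun=> 0); split; first by left.
    by rewrite big1_eq mulr_ge0.
  by rewrite !big1 // => k _; rewrite ?p0 mul0r.
case: (posnP #|I|) => [/card0_eq I0 | /card_gt0P[k1 _]].
  exists (fun=> 0); split; first by left.
    by rewrite big_pred0 // mulr_ge0.
  by rewrite !big_pred0.
have [k0 _ c_max] := arg_maxP c (erefl : xpredT k1).
have [p' [p'_bnd p'k0 sum_p' pc_le]] :=
  shift_mass_to_max p_bnd (c_ge0 k0) (fun k => c_max k isT).
pose c' k := if k == k0 then 0 else c k.
have c'_ge0 k : 0 <= c' k by rewrite /c'; case: ifP.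
have sum_p'_le : \sum_k p' k <= m%:R * M.
  apply: le_trans sum_p' _; rewrite ge_max mulr_ge0 //=.
  by move: sum_p; rewrite -natr1 mulrDl mul1r; lra.
have [q' [q'_vals sum_q' p'q']] := IH p' c' p'_bnd c'_ge0 sum_p'_le.
have q'_ge0 k : 0 <= q' k by case: (q'_vals k) => ->.
exists (fun k => if k == k0 then M else q' k); split.
- by move=> k; case: ifP => _; [right | apply: q'_vals].
- rewrite (bigD1 k0) //= eqxx [m.+1%:R]mulrSr mulrDl mul1r [_ + M]addrC lerD2l.
  rewrite (eq_bigr q'); last by move=> k /negbTE ->.
  by apply: le_trans _ sum_q'; rewrite [X in _ <= X](bigD1 k0) //= lerDr q'_ge0.
have p'c_eq : \sum_k p' k * c k = \sum_k p' k * c' k.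
  by apply: eq_bigr => k _; rewrite /c'; case: eqP => [->|]; rewrite ?p'k0 ?mul0r.
have qc_eq : \sum_k (if k == k0 then M else q' k) * c k
    = M * c k0 + \sum_k q' k * c' k.
  rewrite (bigD1 k0) //= eqxx [X in _ = _ + X](bigD1 k0) //= /c' eqxx mulr0 add0r.
  by congr (_ + _); apply: eq_bigr => k /negbTE ->.
by rewrite qc_eq (le_trans pc_le) // p'c_eq lerD2l.
Qed.

End ExtremeMajorant.

Section Reduction.
Variables (R : realType) (m : nat).
Hypothesis m_gt0 : (0 < m)%N.
Local Notation M := (m%:R^-1 : R).

Let M_gt0 : 0 < M. Proof. by rewrite invr_gt0 ltr0n. Qed.

Let mMK : m%:R * M = 1. Proof. by rewrite divff ?pnatr_eq0 -?lt0n. Qed.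

Lemma per_zero_one_le n (A : 'M[R]_n) : zero_one A -> (forall i, (row_count A i <= m)%N) ->
  per A <= expR (bregman_log m) ^+ n.
Proof.
move=> A01 rA; have [-> | perA_neq0] := eqVneq (per A) 0; first exact/exprn_ge0/expR_ge0.
have perA_gt0 : 0 < per A.
  by rewrite lt0r perA_neq0 per_ge0 // => i j; case: (A01 i j) => ->.
rewrite -(lnK perA_gt0) -expRM_natl ler_expR; apply: le_trans (bregman A01 perA_gt0) _.
rewrite mulr_natl -[in X in _ <= X](card_ord n) -sumr_const ler_sum // => i _.
exact/bregman_log_nondecreasing/rA.
Qed.

Lemma per_extreme_le n (A : 'M[R]_n) : (forall i j, A i j = 0 \/ A i j = M) ->
  (forall i, \sum_j A i j <= 1) -> per A <= (M * expR (bregman_log m)) ^+ n.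
Proof.
move=> A_vals A_rows; pose B := m%:R *: A.
have -> : A = M *: B by rewrite scalerA mulrC mMK scale1r.
have B01 : zero_one B.
  by move=> i j; rewrite mxE; case: (A_vals i j) => ->; [left; rewrite mulr0 | right].
rewrite perZ exprMn ler_wpM2l ?exprn_ge0 ?(ltW M_gt0) //; apply: per_zero_one_le => // i.
rewrite -(ler_nat R) -row_sum_zero_one //.
have -> : \sum_j B i j = m%:R * \sum_j A i j.
  by rewrite mulr_sumr; apply: eq_bigr => j _; rewrite mxE.
by rewrite ler_piMr.
Qed.

Lemma per_row_majorant n (A : 'M[R]_n.+1) i0 : (forall i j, 0 <= A i j <= M) ->
  \sum_j A i0 j <= 1 ->
  exists q : 'I_n.+1 -> R, [/\ forall j, q j = 0 \/ q j = M, \sum_j q j <= 1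
    & per A <= per (\matrix_(i, j) if i == i0 then q j else A i j)].
Proof.
move=> A_bnd A_row.
have cof_ge0 k : 0 <= per (row' i0 (col' k A)).
  by apply: per_ge0 => x y; rewrite !mxE; case/andP: (A_bnd (lift i0 x) (lift k y)).
have [|q [q_vals q_sum pc_le]] :=
  exists_extreme_majorant (m := m) (ltW M_gt0) (A_bnd i0) cof_ge0; first by rewrite mMK.
exists q; split => //; first by rewrite -mMK.
have -> : per (\matrix_(i, j) if i == i0 then q j else A i j)
    = \sum_k q k * per (row' i0 (col' k A)).
  rewrite (expand_per_row _ i0); apply: eq_bigr => k _; rewrite mxE eqxx.
  by congr (_ * per _); apply/matrixP => x y; rewrite !mxE eq_sym (negbTE (neq_lift _ _)).
by rewrite (expand_per_row A i0).
Qed.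

(* Induction on the number of entries outside {0, M}: replacing a row that contains
   one by [per_row_majorant] removes at least one. *)
Lemma per_le_bregman_bound n (A : 'M[R]_n) : (forall i j, 0 <= A i j <= M) ->
  (forall i, \sum_j A i j <= 1) -> per A <= (M * expR (bregman_log m)) ^+ n.
Proof.
case: n A => [|n] A; first by rewrite per0 expr0.
pose frac (B : 'M[R]_n.+1) := [set ij | (B ij.1 ij.2 != 0) && (B ij.1 ij.2 != M)].
have [k] := ubnP #|frac A|; elim: k A => // k IH A frac_lt A_bnd A_rows.
have [frac0 | [[i0 j0] ij0_frac]] := set_0Vmem (frac A).
  apply: per_extreme_le => // i j; have : (i, j) \notin frac A by rewrite frac0 inE.
  by rewrite inE negb_and !negbK => /orP[] /eqP; [left | right].
have [q [q_vals q_sum perA_le]] := per_row_majorant A_bnd (A_rows i0).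
apply: le_trans perA_le (IH _ _ _ _) => [|i j|i].
- rewrite ltnS in frac_lt; apply: leq_trans _ frac_lt; apply/proper_card/properP; split.
    apply/subsetP => -[i j]; rewrite !inE /= mxE.
    by case: (i == i0) => //; case: (q_vals j) => ->; rewrite ?eqxx ?andbF.
  exists (i0, j0) => //; rewrite inE /= mxE eqxx.
  by case: (q_vals j0) => ->; rewrite ?eqxx ?andbF.
- rewrite mxE; case: (i == i0); last exact: A_bnd.
  by case: (q_vals j) => ->; rewrite ?lexx ltW.
- rewrite (eq_bigr (fun j => if i == i0 then q j else A i j)) => [|j _]; last by rewrite mxE.
  by case: (i == i0); [apply: q_sum | apply: A_rows].
Qed.

End Reduction.

Section EntropyFactor.
Variable R : realType.

Lemma expRN_le_powR1B (p : R) : 0 <= p <= 1 -> expR (- p) <= (1 - p) `^ (1 - p).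
Proof.
case/andP=> p_ge0; rewrite le_eqVlt => /orP[/eqP -> | p_lt1].
  by rewrite subrr powRr0 expR_le1 lerN10.
have q_gt0 : 0 < 1 - p by rewrite subr_gt0.
rewrite /powR gt_eqF // ler_expR.
have qV_gt0 : 0 < (1 - p)^-1 by rewrite invr_gt0.
have := ln_le_subr1 qV_gt0; rewrite lnV ?posrE //.
move=> /(ler_wpM2l (ltW q_gt0)); rewrite mulrBr mulfV ?gt_eqF // mulr1 mulrN.
lra.
Qed.

Lemma F_ge_expRN n (P : 'M[R]_n) : (forall i j, 0 <= P i j) ->
  (forall i, \sum_j P i j = 1) -> expR (-1) ^+ n <= F P.
Proof.
move=> P_ge0 P_rows.
have -> : expR (-1) ^+ n = \prod_(i < n) \prod_(j < n) expR (- P i j).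
  rewrite -[in LHS](card_ord n) -prodr_const; apply: eq_bigr => i _.
  by rewrite -expR_sum sumrN P_rows.
apply: ler_prod => i _; rewrite prodr_ge0 => [|j _]; last exact: expR_ge0.
apply: ler_prod => j _; rewrite expR_ge0 expRN_le_powR1B // P_ge0 /=.
by rewrite -(P_rows i) (bigD1 j) //= lerDl sumr_ge0.
Qed.

Lemma expR_bregman_log6_le3 : expR (bregman_log 6) <= 3 :> R.
Proof.
rewrite -(ler_pXn2r (isT : 0 < 6)%N) ?nnegrE ?expR_ge0 // -expRM_natl.
rewrite mulr_bregman_log lnK ?posrE ?ltr0n ?fact_gt0 // (_ : 6`! = 720)%N //; lra.
Qed.

Lemma half_le_sqrt2_expRN1 : 2^-1 <= Num.sqrt 2 * expR (-1) :> R.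
Proof.
have e20 : 19/20 <= expR (- (1/20)) :> R by have := expR_ge1Dx (- (1/20) : R); lra.
have e_ge : (19/20) ^+ 20 <= expR (-1) :> R.
  rewrite -[-1](_ : 20%:R * - (1/20) = -1 :> R) ?expRM_natl; last lra.
  by rewrite lerXn2r ?nnegrE ?expR_ge0 //; lra.
have e_sq : ((19/20) ^+ 20) ^+ 2 <= expR (-1) ^+ 2 :> R.
  by rewrite lerXn2r ?nnegrE ?expR_ge0 //; lra.
rewrite -(ler_pXn2r (isT : 0 < 2)%N) ?nnegrE ?mulr_ge0 ?sqrtr_ge0 ?expR_ge0 //; last lra.
rewrite exprMn sqr_sqrtr //; lra.
Qed.

End EntropyFactor.

Theorem mainTheorem10 (R : realType) (r n : nat) (P : 'M[R]_n) :
  (6 <= r)%N -> (1 <= n)%N ->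
  doubly_stochastic P ->
  (forall i j, P i j <= r%:R^-1) ->
  per P <= (Num.sqrt (2 : R)) ^+ n * F P.
Proof.
move=> r_ge6 _ [P_ge0 [P_rows _]] P_le.
have P_bnd i j : 0 <= P i j <= 6%:R^-1.
  rewrite P_ge0 (le_trans (P_le i j)) // lef_pV2 ?posrE ?ltr0n ?ler_nat //.
  exact: leq_trans r_ge6.
have P_rows_le i : \sum_j P i j <= 1 by rewrite P_rows.
apply: le_trans (per_le_bregman_bound (isT : 0 < 6)%N P_bnd P_rows_le) _.
apply: le_trans (_ : _ <= (Num.sqrt 2 * expR (-1)) ^+ n) _.
  rewrite lerXn2r ?nnegrE ?mulr_ge0 ?sqrtr_ge0 ?expR_ge0 ?invr_ge0 ?ler0n //.
  apply: le_trans _ (half_le_sqrt2_expRN1 R).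
  have := expR_bregman_log6_le3 R; lra.
by rewrite exprMn ler_wpM2l ?exprn_ge0 ?sqrtr_ge0 // F_ge_expRN.
Qed.
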